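(* Let $R$ be a commutative Noetherian ring of prime characteristic $p$. If the proper ideal $\mathfrak{A}$ of the perfect closure $R^{\infty}$ has a primary decomposition, then the $f$-sequence $(\mathfrak{a}_n)_{n\in\mathbb{N}_0}$ of ideals of $R$ corresponding to $\mathfrak{A}$ has linear growth of primary decompositions, and $\bigcup_{n\in\mathbb{N}_0}\operatorname{ass}\mathfrak{a}_n$ is a finite set.
   Context: Rings have identity; $\mathbb{N}_0$ is the set of non-negative integers. $f:R\to R$, $r\mapsto r^p$, is the Frobenius homomorphism. For an ideal $\mathfrak{a}$ of $R$, $\mathfrak{a}^{[p^n]}$ is the ideal generated by all $p^n$-th powers of elements of $\mathfrak{a}$. Perfect closure: a ring of characteristic $p$ is perfect if its Frobenius homomorphism is bijective. $R^{\infty}$ is the perfect closure of $R$: a perfect commutative ring with a ring homomorphism $\psi_0:R\to R^{\infty}$ that is universal for ring homomorphisms from $R$ to perfect commutative rings of characteristic $p$. One has $\ker\psi_0=\sqrt{(0)}$, and each $\alpha\in R^\infty$ satisfies $\alpha^{p^m}\in\psi_0(R)$ for some $m\ge 0$. Put $\overline{r}=\psi_0(r)$, let $\overline{r}^{1/p^n}$ be its unique $p^n$-th root in $R^{\infty}$, and let $\psi_n:R\to R^{\infty}$ be the ring homomorphism $\psi_n(r)=\overline{r}^{1/p^n}$. An $f$-sequence of ideals of $R$ is a sequence $(\mathfrak{a}_n)_{n\in\mathbb{N}_0}$ of ideals of $R$ with $f^{-1}(\mathfrak{a}_{n+1})=\mathfrak{a}_n$ for all $n$. The map $\mathfrak{A}\mapsto(\psi_n^{-1}(\mathfrak{A}))_{n\in\mathbb{N}_0}$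 is a bijection from the set of ideals of $R^{\infty}$ to the set of $f$-sequences of ideals of $R$, with inverse $(\mathfrak{a}_n)_n\mapsto\bigcup_n\psi_n(\mathfrak{a}_n)$; ''corresponding'' refers to this bijection. An ideal of a (not necessarily Noetherian) commutative ring has a primary decomposition if it is an intersection of finitely many primary ideals. For an ideal $\mathfrak{a}$ of $R$, $\operatorname{ass}\mathfrak{a}$ is the set of associated primes of $\mathfrak{a}$, i.e. the radicals of the components of a minimal primary decomposition of $\mathfrak{a}$. An $f$-sequence $(\mathfrak{a}_n)_n$ of proper ideals of $R$ has $h$-linear growth of primary decompositions ($h$ a positive integer) if for every $n\in\mathbb{N}_0$ there is a minimal primary decomposition $\mathfrak{a}_n=\mathfrak{q}_{1,n}\cap\cdots\cap\mathfrak{q}_{k_n,n}$ with $\big((\sqrt{\mathfrak{q}_{i,n}})^{[p^n]}\big)^h\subseteq\mathfrak{q}_{i,n}$ for all $i=1,\ldots,k_n$. It has linear growth of primary decompositions if it has $h$-linear growth for some positive integer $h$. *)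

(* Defs.v *)
From mathcomp Require Import all_boot all_algebra.
From mathcomp Require Import all_classical.

Set Implicit Arguments.
Unset Strict Implicit.
Unset Printing Implicit Defensive.

Import GRing.Theory.
Local Open Scope classical_set_scope.
Local Open Scope ring_scope.

(* MathComp's [idealr_closed] concerns boolean predicates and forces ideals to
   be proper; here ideals are arbitrary subsets and may be the whole ring. *)
Definition is_ideal (R : comNzRingType) (I : set R) : Prop :=
  [/\ I 0,
      forall x y, I x -> I y -> I (x + y)
    & forall a x, I x -> I (a * x)].

Definition is_proper_ideal (R : comNzRingType) (I : set R) : Prop :=
  is_ideal I /\ I <> setT.

Definition ideal_gen (R : comNzRingType) (X : set R) : set R :=
  smallest (@is_ideal R) X.

Definition noetherian (R : comNzRingType) : Prop :=
  forall I : set R, is_ideal I -> exists s : seq R, I = ideal_gen [set` s].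

Definition radical (R : comNzRingType) (I : set R) : set R :=
  [set x | exists n : nat, I (x ^+ n)].

Definition ideal_mul (R : comNzRingType) (I J : set R) : set R :=
  ideal_gen [set x * y | x in I & y in J].

Definition ideal_exp (R : comNzRingType) (I : set R) (h : nat) : set R :=
  iter h (ideal_mul I) setT.

(* The ideal $I^{[p^n]}$. *)
Definition frobenius_power (R : comNzRingType) (p n : nat) (I : set R) :
    set R :=
  ideal_gen [set x ^+ (p ^ n)%N | x in I].

Definition primary_ideal (R : comNzRingType) (Q : set R) : Prop :=
  is_proper_ideal Q /\ forall x y, Q (x * y) -> Q x \/ radical Q y.

Definition primary_decomposition (R : comNzRingType) (I : set R) (k : nat)
    (q : 'I_k -> set R) : Prop :=
  (forall i, primary_ideal (q i)) /\ I = \bigcap_(i in setT) q i.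

Definition minimal_primary_decomposition (R : comNzRingType) (I : set R)
    (k : nat) (q : 'I_k -> set R) : Prop :=
  [/\ primary_decomposition I q,
      injective (fun i => radical (q i))
    & forall i, ~ (\bigcap_(j in [set j | j != i]) q j `<=` q i)].

Definition has_primary_decomposition (R : comNzRingType) (I : set R) : Prop :=
  exists (k : nat) (q : 'I_k -> set R), primary_decomposition I q.

(* By the first uniqueness theorem the radicals do not depend on the minimal
   primary decomposition; here they are collected over all of them. *)
Definition ass (R : comNzRingType) (I : set R) : set (set R) :=
  [set P | exists (k : nat) (q : 'I_k -> set R),
     minimal_primary_decomposition I q /\ exists i, P = radical (q i)].

Definition perfect_ring (p : nat) (R : comNzRingType) : Prop :=
  p \in [pchar R] /\ bijective (fun x : R => x ^+ p).

Definition is_perfect_closure (p : nat) (R S : comNzRingType)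
    (psi0 : {rmorphism R -> S}) : Prop :=
  perfect_ring p S /\
  forall T : comNzRingType, perfect_ring p T ->
  forall g : {rmorphism R -> T},
    exists2 h : {rmorphism S -> T}, h \o psi0 =1 g
      & forall h' : {rmorphism S -> T}, h' \o psi0 =1 g -> h' =1 h.

(* The $p^n$-th root of [psi0 r]; it exists and is unique when [S] is perfect,
   so the default value 0 of [xget] is then irrelevant. *)
Definition psi (p : nat) (R S : comNzRingType) (psi0 : {rmorphism R -> S})
    (n : nat) (r : R) : S :=
  xget 0 [set s : S | s ^+ (p ^ n)%N = psi0 r].

Definition corresponding_fseq (p : nat) (R S : comNzRingType)
    (psi0 : {rmorphism R -> S}) (A : set S) (n : nat) : set R :=
  psi p psi0 n @^-1` A.

Definition f_sequence (p : nat) (R : comNzRingType) (a : nat -> set R) : Prop :=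
  (forall n, is_ideal (a n)) /\
  forall n, (fun r : R => r ^+ p) @^-1` a n.+1 = a n.

Definition h_linear_growth (p : nat) (R : comNzRingType) (a : nat -> set R)
    (h : nat) : Prop :=
  [/\ f_sequence p a,
      forall n, is_proper_ideal (a n)
    & forall n, exists (k : nat) (q : 'I_k -> set R),
        minimal_primary_decomposition (a n) q /\
        forall i, ideal_exp (frobenius_power p n (radical (q i))) h `<=` q i].

Definition linear_growth (p : nat) (R : comNzRingType) (a : nat -> set R) :
    Prop :=
  exists2 h : nat, (0 < h)%N & h_linear_growth p a h.

(* Main.v *)
(* Pulling a primary decomposition of A back along psi_n gives a primary
   decomposition of a_n whose radicals are the contractions of the radicals of
   the components Q of A along psi_0, independently of n; this bounds
   the associated primes.  For such a Q let I be its contraction along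
   psi_0.  Since R is Noetherian, rad(I)^h is contained in I for some h.  As
   psi_n (x ^ (p ^ n)) = psi_0 x, the h-th power of rad(I)^[p^n] is then mapped
   into Q by psi_n, for every n with this same h.  The bound survives both
   reductions to a minimal decomposition: dropping a redundant component, and
   intersecting two components with the same radical. *)
Require Import Defs.
From HB Require Import structures.
From mathcomp Require Import all_boot all_algebra.
From mathcomp Require Import all_classical.

Set Implicit Arguments.
Unset Strict Implicit.
Unset Printing Implicit Defensive.

Import GRing.Theory.
Local Open Scope classical_set_scope.
Local Open Scope ring_scope.

(** * Ideals, radicals and primary ideals *)

Lemma ideal_mulr (R : comNzRingType) (I : set R) (x a : R) :
  is_ideal I -> I x -> I (x * a).
Proof. by move=> [_ _ IM] Ix; rewrite mulrC; exact: IM. Qed.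

Lemma ideal_expr (R : comNzRingType) (I : set R) (x : R) (m n : nat) :
  is_ideal I -> (m <= n)%N -> I (x ^+ m) -> I (x ^+ n).
Proof. by move=> idI lemn Ixm; rewrite -(subnKC lemn) exprD; apply: ideal_mulr. Qed.

Lemma ideal_gen_sub (R : comNzRingType) (X I : set R) :
  is_ideal I -> X `<=` I -> ideal_gen X `<=` I.
Proof. by move=> idI XI; apply: smallest_sub. Qed.

Lemma ideal_colon (R : comNzRingType) (I : set R) (x : R) :
  is_ideal I -> is_ideal [set y | I (x * y)].
Proof.
move=> [I0 ID IM]; split=> /= [|y z|a y]; first by rewrite mulr0.
- by rewrite mulrDr; exact: ID.
- by rewrite mulrCA; exact: IM.
Qed.

Lemma idealI (R : comNzRingType) (I J : set R) :
  is_ideal I -> is_ideal J -> is_ideal (I `&` J).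
Proof.
move=> [I0 ID IM] [J0 JD JM]; split=> // [x y [Ix Jx] [Iy Jy]|a x [Ix Jx]].
- by split; [exact: ID | exact: JD].
- by split; [exact: IM | exact: JM].
Qed.

Lemma proper_ideal1 (R : comNzRingType) (I : set R) :
  is_proper_ideal I -> ~ I 1.
Proof.
move=> [idI IT] I1; apply: IT; apply/seteqP; split=> // x _.
by rewrite -[x]mul1r; exact: ideal_mulr.
Qed.

Lemma ideal_proper (R : comNzRingType) (I : set R) :
  is_ideal I -> ~ I 1 -> is_proper_ideal I.
Proof. by move=> idI I1; split=> // IT; apply: I1; rewrite IT. Qed.

Lemma radical_expr (R : comNzRingType) (I : set R) (x : R) (n : nat) :
  radical I (x ^+ n) -> radical I x.
Proof. by move=> [m Ixnm]; exists (n * m)%N; rewrite exprM. Qed.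

Lemma radicalI (R : comNzRingType) (I J : set R) :
  is_ideal I -> is_ideal J -> radical (I `&` J) = radical I `&` radical J.
Proof.
move=> idI idJ; apply/seteqP; split=> [x [n [In Jn]]|x [[m Im] [n Jn]]].
  by split; exists n.
exists (m + n)%N; split.
- by apply: ideal_expr Im; rewrite ?leq_addr.
- by apply: ideal_expr Jn; rewrite ?leq_addl.
Qed.

Lemma radical_ideal (R : comNzRingType) (I : set R) :
  is_ideal I -> is_ideal (radical I).
Proof.
move=> idI; have [I0 ID IM] := idI; split=> [|x y [m Im] [n In]|a x [n In]].
- by exists 1%N; rewrite expr1.
(* Each term of the binomial expansion has exponent at least [m] on [x] or at least [n] on [y]. *)
- exists (m + n)%N; rewrite exprDn.
  apply: (big_ind I) => // i _; rewrite -mulr_natr; apply: ideal_mulr => //.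
  have [lein|ltni] := leqP i n.
    by apply: ideal_mulr => //; apply: ideal_expr Im; rewrite -?addnBA ?leq_addr.
  by apply: IM; apply: ideal_expr In => //; exact: ltnW.
- by exists n; rewrite exprMn; exact: IM.
Qed.

Lemma primary_ideal_is_ideal (R : comNzRingType) (Q : set R) :
  primary_ideal Q -> is_ideal Q.
Proof. by case=> -[]. Qed.

Lemma primary_radical1 (R : comNzRingType) (Q : set R) :
  primary_ideal Q -> ~ radical Q 1.
Proof. by move=> [prQ _] [n]; rewrite expr1n; exact: proper_ideal1. Qed.

Lemma primary_radical_prime (R : comNzRingType) (Q : set R) (x y : R) :
  primary_ideal Q -> radical Q (x * y) -> radical Q x \/ radical Q y.
Proof.
move=> [_ primQ] [n]; rewrite exprMn => /primQ[Qx|Qy].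
- by left; exists n.
- by right; exact: radical_expr Qy.
Qed.

(** If [x] escapes one of the two ideals, then [y] lies in the common radical, which is also the
    radical of the intersection. *)
Lemma primary_idealI (R : comNzRingType) (Q Q' : set R) :
  primary_ideal Q -> primary_ideal Q' -> radical Q = radical Q' ->
  primary_ideal (Q `&` Q').
Proof.
move=> primQ primQ' eqr.
have idQ := primary_ideal_is_ideal primQ.
have idQ' := primary_ideal_is_ideal primQ'.
split.
  apply: ideal_proper; first exact: idealI.
  by move=> [Q1 _]; apply: (proper_ideal1 primQ.1).
move=> x y [Qxy Q'xy]; rewrite radicalI // -eqr setIid.
have [Qx|] := primQ.2 _ _ Qxy; last by right.
by have [Q'x|] := primQ'.2 _ _ Q'xy; [left | rewrite -eqr; right].
Qed.

(** * Contraction of ideals along a ring homomorphism *)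

Section Preimage.
Variables (R S : comNzRingType) (g : {rmorphism R -> S}).

Lemma preimage_ideal (I : set S) : is_ideal I -> is_ideal (g @^-1` I).
Proof.
move=> [I0 ID IM]; split=> /= [|x y|a x]; first by rewrite rmorph0.
- by rewrite rmorphD; exact: ID.
- by rewrite rmorphM; exact: IM.
Qed.

Lemma preimage_proper_ideal (I : set S) :
  is_proper_ideal I -> is_proper_ideal (g @^-1` I).
Proof.
move=> prI; apply: ideal_proper; first exact: preimage_ideal prI.1.
by rewrite /= rmorph1; exact: proper_ideal1.
Qed.

Lemma preimage_radical (I : set S) : radical (g @^-1` I) = g @^-1` radical I.
Proof.
by apply/seteqP; split=> x /= [n In]; exists n; move: In; rewrite /= rmorphXn.
Qed.

Lemma preimage_primary_ideal (Q : set S) :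
  primary_ideal Q -> primary_ideal (g @^-1` Q).
Proof.
move=> [prQ primQ]; split; first exact: preimage_proper_ideal.
by move=> x y; rewrite preimage_radical /= rmorphM; exact: primQ.
Qed.

Lemma preimage_primary_decomposition (I : set S) (k : nat) (q : 'I_k -> set S) :
  primary_decomposition I q ->
  primary_decomposition (g @^-1` I) (fun i => g @^-1` q i).
Proof.
move=> [primq ->]; split=> [i|]; first exact: preimage_primary_ideal.
by rewrite preimage_bigcap.
Qed.

End Preimage.

(** * Powers of finitely generated ideals *)

Section FinitelyGenerated.
Variable R : comNzRingType.

(** With all other factors fixed, the condition on one factor defines a colon ideal, so each factor
    may be tested on generators alone. The induction on [h] replaces [I] by such colon ideals. *)
Lemma ideal_exp_gen_sub (X I : set R) (h : nat) : is_ideal I ->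
  (forall w : seq R, size w = h -> [set` w] `<=` X -> I (\prod_(x <- w) x)) ->
  ideal_exp (ideal_gen X) h `<=` I.
Proof.
elim: h I => [|h IHh] I idI IX.
  move=> x _; rewrite -[x]mul1r; apply: ideal_mulr => //.
  by have := IX [::] erefl; rewrite big_nil; apply.
apply: ideal_gen_sub => // _ [x genx [y expy <-]]; rewrite mulrC.
apply: (ideal_gen_sub (ideal_colon y idI)) genx => z Xz /=; rewrite mulrC.
apply: (IHh _ (ideal_colon z idI)) expy => w szw wX /=.
have := IX (z :: w); rewrite big_cons /= szw; apply=> // t.
by rewrite /= inE => /orP[/eqP ->|/wX].
Qed.

Lemma prod_in_ideal_exp (I : set R) (w : seq R) :
  [set` w] `<=` I -> ideal_exp I (size w) (\prod_(x <- w) x).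
Proof.
elim: w => [|x w IHw] wI; first by rewrite big_nil.
rewrite big_cons; apply: sub_gen_smallest.
exists x; first by apply: wI; rewrite /= mem_head.
exists (\prod_(y <- w) y) => //; apply: IHw => y yw.
by apply: wI; rewrite /= inE (yw : y \in w) orbT.
Qed.

(** Pigeonhole: if [x ^+ m] is in [I] and [h] works for the remaining letters, a word of length
    [m + h] contains [m] copies of [x] or at least [h] other letters. *)
Lemma long_product_in_ideal (I : set R) (s : seq R) : is_ideal I ->
  [set` s] `<=` radical I ->
  exists h, forall w : seq R, (h <= size w)%N -> {subset w <= s} ->
    I (\prod_(x <- w) x).
Proof.
move=> idI; have [_ _ IM] := idI.
elim: s => [|x s IHs] sI.
  (* The bound 1 excludes the empty word, whose product 1 need not lie in [I]. *)
  exists 1%N => -[//|y w _] /(_ y); rewrite mem_head => /(_ isT).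
  by rewrite in_nil.
have [y ys|h hP] := IHs.
  by apply: sI; rewrite /= inE (ys : y \in s) orbT.
have [m Im] : radical I x by apply: sI; rewrite /= mem_head.
exists (m + h)%N => w lew ws.
rewrite (bigID (pred1 x)) /= (eq_bigr (fun=> x)) => [|y /eqP //].
rewrite big_const_seq iter_mulr_1 -[X in _ * X]big_filter.
have [lem|ltm] := leqP m (count_mem x w).
  by apply: ideal_mulr => //; exact: ideal_expr Im.
apply: IM; apply: hP => [|y].
  rewrite size_filter; move: lew; rewrite -(count_predC (pred1 x) w) => lew.
  have := leq_trans lew (leq_add (ltnW ltm) (leqnn _)).
  by rewrite leq_add2l.
by rewrite mem_filter => /andP[/= /negPf nyx /ws]; rewrite inE nyx.
Qed.

(** Finitely many elements generate the radical, and long products of them fall into [I]. Allowing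
    every larger exponent lets finitely many ideals share one bound. *)
Lemma noetherian_exp_radical_sub (I : set R) :
  noetherian R -> is_ideal I ->
  exists h, forall n, (h <= n)%N -> ideal_exp (radical I) n `<=` I.
Proof.
move=> noethR idI; have [s es] := noethR _ (radical_ideal idI).
have [h hP] : exists h, forall w : seq R, (h <= size w)%N ->
    {subset w <= s} -> I (\prod_(x <- w) x).
  by apply: long_product_in_ideal => //; rewrite es; exact: sub_gen_smallest.
exists h => n lehn; rewrite es; apply: ideal_exp_gen_sub => // w szw ws.
by apply: hP; rewrite ?szw.
Qed.

End FinitelyGenerated.

(** * Minimal primary decompositions and associated primes *)

Section Decompositions.
Variables (R : comNzRingType) (I : set R).

Lemma decomposition_lift (k : nat) (q : 'I_k.+1 -> set R) (i : 'I_k.+1) :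
  \bigcap_(j in setT) q j = q i `&` \bigcap_(j in setT) q (lift i j).
Proof.
apply/seteqP; split=> x; first by move=> qx; split=> [|j _]; exact: qx.
by move=> [qi ql] j _; have [l ->|->] := unliftP i j; [exact: ql|].
Qed.

(** A decomposition that is not minimal has a redundant component, which is dropped, or two
    components with equal radicals, which are merged; both lower [k]. Only merging creates a new
    component, so [C] need only survive that. *)
Lemma minimal_primary_decomposition_exists (C : set (set R)) (k : nat)
    (q : 'I_k -> set R) :
  (forall Q Q', C Q -> C Q' -> radical Q = radical Q' -> C (Q `&` Q')) ->
  primary_decomposition I q -> (forall i, C (q i)) ->
  exists (k' : nat) (q' : 'I_k' -> set R),
    minimal_primary_decomposition I q' /\ forall i, C (q' i).
Proof.
move=> CI; elim: k q => [|k IHk] q decq Cq.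
  by exists 0%N, q; split=> //; split=> // -[].
have [minq|] := pselect (minimal_primary_decomposition I q).
  by exists k.+1, q.
have [primq defI] := decq.
have [injq|ninj] := pselect (injective (fun i => radical (q i))).
  have [irr|red _] :=
    pselect (forall i, ~ (\bigcap_(j in [set j | j != i]) q j `<=` q i)).
    by case.
  have [i subi] : exists i, \bigcap_(j in [set j | j != i]) q j `<=` q i.
    apply: contrapT => nex; apply: red => i subi.
    by apply: nex; exists i.
  apply: (IHk (q \o lift i)) => [|j]; last exact: Cq.
  split=> [j|]; first exact: primq.
  rewrite defI (decomposition_lift q i); apply/setIidr => x qx.
  apply: subi => j /= ji; have [l ->|ej] := unliftP i j; first exact: qx.
  by rewrite ej eqxx in ji.
move=> _.
have [i [j [eqij nij]]] : exists i j, radical (q i) = radical (q j) /\ i != j.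
  apply: contrapT => nex; apply: ninj => i j /= eqij.
  apply/eqP; apply: contrapT => nij; apply: nex; exists i, j.
  by split=> //; exact/negP.
(* Slot [i] disappears, and slot [j] receives the intersection of both components. *)
pose q' l := if lift i l == j then q i `&` q j else q (lift i l).
have [l ej|ej] := unliftP i j; last by rewrite ej eqxx in nij.
apply: (IHk q') => [|m]; last by rewrite /q'; case: ifP => _; [exact: CI|].
split=> [m|].
  by rewrite /q'; case: ifP => _; [exact: primary_idealI | exact: primq].
rewrite defI (decomposition_lift q i); apply/seteqP; split=> x.
  move=> [qi ql] m _; rewrite /q'; case: ifP => _; last exact: ql.
  by split=> //; rewrite ej; exact: ql.
move=> q'x; have := q'x l Logic.I; rewrite /q' -ej eqxx => -[qi qj].
split=> // m _; have := q'x m Logic.I; rewrite /q'.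
by case: ifP => [/eqP ->|].
Qed.

(* First uniqueness theorem: for x outside the i-th component of a minimal
   decomposition but inside all others, rad (I : x) is the i-th radical; any
   other decomposition writes it as a finite intersection of radicals, and a
   prime equal to a finite intersection is one of its members. *)
Lemma ass_primary_decomposition (k : nat) (q : 'I_k -> set R) (P : set R) :
  primary_decomposition I q -> ass I P -> exists j, P = radical (q j).
Proof.
move=> [primq defI] [k' [q' [[[primq' defI'] _ irr] [i ->]]]].
have [x [xother xi]] :
    exists x, (\bigcap_(j in [set j | j != i]) q' j) x /\ ~ q' i x.
  apply: contrapT => nex; apply: (irr i) => x xother.
  by apply: contrapT => xi; apply: nex; exists x.
have colon_rad y : I (x * y) -> radical (q' i) y.
  by rewrite defI' => /(_ i Logic.I) /(primq' i).2 [].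
have rad_colon y : radical (q' i) y -> exists n, I (x * y ^+ n).
  move=> [n q'y]; exists n; rewrite defI' => j _.
  have idj := primary_ideal_is_ideal (primq' j).
  have [->|ji] := eqVneq j i; last by apply: ideal_mulr => //; exact: xother.
  by have [_ _ IM] := primary_ideal_is_ideal (primq' i); exact: IM.
apply: contrapT => nex.
(* If the prime [radical (q' i)] differs from every [radical (q j)], each [q j] yields a multiplier
   of [x] outside this prime. The product of these multipliers sends [x] into [I], hence lies in the
   prime: a contradiction. *)
have /choice[z zP] j : exists z, ~ radical (q' i) z /\ q j (x * z).
  have idj := primary_ideal_is_ideal (primq j); have [_ _ IM] := idj.
  have [qx|nqx] := pselect (q j x).
    by exists 1; split; [exact: primary_radical1 | rewrite mulr1].
  have radS : radical (q' i) `<=` radical (q j).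
    move=> y /rad_colon[n]; rewrite defI => /(_ j Logic.I) /(primq j).2[//|].
    exact: radical_expr.
  have [y [[n qy] ny]] : exists y, radical (q j) y /\ ~ radical (q' i) y.
    apply: contrapT => nexy; apply: nex; exists j; apply/seteqP; split=> // y qy.
    by apply: contrapT => ny; apply: nexy; exists y.
  exists (y ^+ n); split; last exact: IM.
  by move=> /radical_expr.
have : radical (q' i) (\prod_j z j).
  apply: colon_rad; rewrite defI => j _; rewrite (bigD1 j) //= mulrA.
  apply: ideal_mulr; last exact: (zP j).2.
  exact: primary_ideal_is_ideal.
apply: (big_ind (fun y => ~ radical (q' i) y)) => [|y t ny nt|j _].
- exact: primary_radical1.
- by move=> /primary_radical_prime[].
- exact: (zP j).1.
Qed.

End Decompositions.

(** * Iterated Frobenius roots in a perfect ring *)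

Section PerfectTarget.
Variables (p : nat) (R S : comNzRingType) (psi0 : {rmorphism R -> S}).
Hypothesis perfS : perfect_ring p S.

Lemma perfect_expr_bij (n : nat) : bijective (fun x : S => x ^+ (p ^ n)%N).
Proof.
elim: n => [|n IHn]; first by exists id => x; rewrite expn0 expr1.
by apply: (eq_bij (bij_comp perfS.2 IHn)) => x /=; rewrite -exprM -expnSr.
Qed.

Lemma psi_expr (n : nat) (r : R) : psi p psi0 n r ^+ (p ^ n)%N = psi0 r.
Proof.
have [g _ gK] := perfect_expr_bij n.
exact: (@xgetPex _ 0 [set s : S | s ^+ (p ^ n)%N = psi0 r]
  (ex_intro _ (g (psi0 r)) (gK _))).
Qed.

Lemma psi_unique (n : nat) (r : R) (s : S) :
  s ^+ (p ^ n)%N = psi0 r -> psi p psi0 n r = s.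
Proof. by move=> es; apply: (bij_inj (perfect_expr_bij n)); rewrite psi_expr. Qed.

(** In characteristic [p] raising to the power [p ^ n] respects sums and products, so uniqueness of
    roots transfers this to [psi]. *)
Lemma psi_rmorphism (n : nat) :
  exists g : {rmorphism R -> S}, psi p psi0 n = g :> (R -> S).
Proof.
have powN : [pchar S].-nat (p ^ n)%N.
  rewrite pnatX pnatE ?(pcharf_prime perfS.1) //.
  by rewrite perfS.1.
have psiB : zmod_morphism (psi p psi0 n).
  move=> x y; apply: psi_unique.
  by rewrite exprDn_pchar // exprNn_pchar // !psi_expr rmorphB.
have psiM : monoid_morphism (psi p psi0 n).
  split=> [|x y]; apply: psi_unique; first by rewrite expr1n rmorph1.
  by rewrite exprMn !psi_expr rmorphM.
pose g : {rmorphism R -> S} := HB.pack (psi p psi0 n)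
  (GRing.isZmodMorphism.Build R S _ psiB)
  (GRing.isMonoidMorphism.Build R S _ psiM).
by exists g.
Qed.

Lemma psi_f_sequence (A : set S) :
  is_ideal A -> f_sequence p (corresponding_fseq p psi0 A).
Proof.
move=> idA; split=> n.
  by rewrite /corresponding_fseq; have [g ->] := psi_rmorphism n; exact: preimage_ideal.
rewrite /corresponding_fseq; apply/seteqP.
(* The [f]-sequence condition reduces to the compatibility of consecutive root maps with
   Frobenius. *)
suff psiS r : psi p psi0 n.+1 (r ^+ p) = psi p psi0 n r.
  by split=> r /=; rewrite psiS.
by apply: psi_unique; rewrite expnSr exprM psi_expr rmorphXn.
Qed.

(* The radical does not depend on [n], because y ^ (p ^ n) and y lie in the
   same radical ideals. *)
Lemma radical_preimage_psi (Q : set S) (n : nat) : is_ideal Q ->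
  radical (psi p psi0 n @^-1` Q) = psi0 @^-1` radical Q.
Proof.
move=> idQ; have [g eg] := psi_rmorphism n.
rewrite eg preimage_radical -eg; apply/seteqP.
split=> r /=; rewrite -(psi_expr n); last exact: radical_expr.
move=> [m Qm]; exists m; rewrite -exprM; apply: ideal_expr Qm => //.
by rewrite leq_pmull // expn_gt0 prime_gt0 // (pcharf_prime perfS.1).
Qed.

(** A product of [h] generators is the [p ^ n]-th power of a product of [h] elements of [I], and
    [psi p psi0 n] sends it to the image of that product under [psi0]. *)
Lemma frobenius_power_exp_sub_preimage_psi (I : set R) (Q : set S)
    (h n : nat) : is_ideal Q ->
  ideal_exp I h `<=` psi0 @^-1` Q ->
  ideal_exp (frobenius_power p n I) h `<=` psi p psi0 n @^-1` Q.
Proof.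
move=> idQ IQ; have [g eg] := psi_rmorphism n.
apply: ideal_exp_gen_sub; first by rewrite eg; exact: preimage_ideal.
move=> w szw wI.
(* Roots matter only for letters of [w]; elsewhere the choice is the dummy 0. *)
have /choice[root rootP] (y : R) :
    exists x, y \in w -> I x /\ x ^+ (p ^ n)%N = y.
  have [yw|_] := boolP (y \in w); last by exists 0.
  by have [x Ix <-] := wI y yw; exists x.
have -> : \prod_(y <- w) y = (\prod_(x <- map root w) x) ^+ (p ^ n)%N.
  rewrite big_map -prodrXl; apply: eq_big_seq => y yw.
  by rewrite (rootP y yw).2.
rewrite /= (psi_unique (s := psi0 (\prod_(x <- map root w) x))); last first.
  by rewrite rmorphXn.
apply: IQ; rewrite -szw -(size_map root); apply: prod_in_ideal_exp.
by move=> _ /mapP[y yw ->]; exact: (rootP y yw).1.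
Qed.

End PerfectTarget.

Theorem theorem7p9 (p : nat) (R : comNzRingType) (pcharRp : p \in [pchar R])
    (noethR : noetherian R)
    (Rinf : comNzRingType) (psi0 : {rmorphism R -> Rinf})
    (closR : is_perfect_closure p psi0)
    (A : set Rinf) (properA : is_proper_ideal A)
    (decA : has_primary_decomposition A) :
  linear_growth p (corresponding_fseq p psi0 A) /\
  finite_set (\bigcup_(n in setT) ass (corresponding_fseq p psi0 A n)).
Proof.
have perfS := closR.1; have [k [Q decQ]] := decA.
have idQ j : is_ideal (Q j) by exact: primary_ideal_is_ideal (decQ.1 j).
have decn n : primary_decomposition (corresponding_fseq p psi0 A n)
    (fun j => psi p psi0 n @^-1` Q j).
  rewrite /corresponding_fseq; have [g ->] := psi_rmorphism psi0 perfS n.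
  exact: preimage_primary_decomposition.
split.
  have /choice[h hP] j : exists h, forall n, (h <= n)%N ->
      ideal_exp (psi0 @^-1` radical (Q j)) n `<=` psi0 @^-1` Q j.
    rewrite -preimage_radical; apply: noetherian_exp_radical_sub => //.
    exact: preimage_ideal.
  (* The maximum serves all components at once; the successor makes the bound positive even when the
     maximum is 0. *)
  exists (\max_j h j).+1 => //; split=> [|n|n].
  - exact: psi_f_sequence properA.1.
  - rewrite /corresponding_fseq; have [g ->] := psi_rmorphism psi0 perfS n.
    exact: preimage_proper_ideal.
  (* The growth bound survives merging because the radical is unchanged; being an ideal is included
     so that the radical of an intersection can be computed. *)
  have [] := @minimal_primary_decomposition_exists _ _ (fun q => is_ideal q /\
    ideal_exp (frobenius_power p n (radical q)) (\max_j h j).+1 `<=` q) _ _ _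
    (decn n).
  - move=> q q' [idq qP] [idq' q'P] eqr; split; first exact: idealI.
    rewrite radicalI // -eqr setIid subsetI; split=> //.
    by rewrite eqr.
  - move=> j; split; first exact: primary_ideal_is_ideal ((decn n).1 j).
    rewrite radical_preimage_psi //.
    apply: frobenius_power_exp_sub_preimage_psi => //; apply: hP.
    by apply: ltnW; rewrite ltnS; exact: leq_bigmax.
  by move=> k' [q [minq Cq]]; exists k', q; split=> // i; exact: (Cq i).2.
(* One family of primes, indexed by the components of [A], covers every [n]. *)
apply: (@sub_finite_set _ _ (range (fun j => psi0 @^-1` radical (Q j)))).
  move=> P [n _ /(ass_primary_decomposition (decn n))[j ->]].
  by exists j => //; rewrite radical_preimage_psi.
exact/finite_image/finite_finset.
Qed.
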